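(* Let $\Omega=\{x\in\mathbb{R}^n\mid Ax\leq b\}$, $\Omega_u=\{u\in\mathbb{R}^n\mid u_i^{\min}\leq u_i\leq u_i^{\max}\ \forall i\}$, and $F(x)=Q(x)+Lx$. Let \[ z=\min_{x\in\partial\Omega,\ u\in\Omega_u}\ \max_{\|\lambda\|=1}\ \lambda^T\left(F(x)-u\right). \] If there is an $r>0$ such that $r\leq e_i$ for all $i$ with $e_i>0$, where $e_i$ denotes the error bound associated with $u_i^{\min}$ and $u_i^{\max}$, and if $z>0$, then the system is robust feasible and has a robustness margin of at least $r$.
   Context: Data: $Q:\mathbb{R}^n\to\mathbb{R}^n$ is a quadratic map, $[Q(x)]_i=x^TQ_ix$ with $Q_1,\dots,Q_n\in\mathbb{R}^{n\times n}$; $L\in\mathbb{R}^{n\times n}$; $A\in\mathbb{R}^{m\times n}$, $b\in\mathbb{R}^m$, where the system $Ax\le b$ is free of redundant constraints and $\Omega$ is bounded; $u^*\in\mathbb{R}^n$ and $e\in\mathbb{R}^n$ with $e_i\ge0$, and $u_i^{\min}=u_i^*-e_i$, $u_i^{\max}=u_i^*+e_i$. Inequalities between vectors are componentwise; $\lambda$ ranges over $\mathbb{R}^n$ and $\|\cdot\|$ is the Euclidean norm. Definitions: the system (given by $F(x)=u$, $Ax\le b$ and $u\in\Omega_u$) is robust feasible if for every $u\in\Omega_u$ the equation $F(x)=u$ has a solution $x$ in the interior of $\Omega$. The robustness margin is the largest $r$ for which $e_i\ge r$ for all $i$ with $e_i>0$ and such that the system is robust feasible. Standing assumptions: (i) the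 topological (Brouwer) degree of the map $x\mapsto F(x)-u^*$ at $0$ over the interior of $\Omega$ is defined (i.e. $F(x)\neq u^*$ for $x\in\partial\Omega$) and nonzero; (ii) $\partial F(\Omega)=F(\partial\Omega)$, where $\partial$ denotes topological boundary in $\mathbb{R}^n$. *)

(* Defs.v *)
(* Vectors of R^n are row vectors 'rV[R]_n, so that the library's Jacobian
   'J f x applies; accordingly M x is written x *m M^T. *)
From mathcomp Require Import all_boot all_order all_algebra.
From mathcomp Require Import all_classical all_reals all_analysis.

Set Implicit Arguments.
Unset Strict Implicit.
Unset Printing Implicit Defensive.

Import Order.TTheory GRing.Theory Num.Theory.
Import numFieldNormedType.Exports.

Local Open Scope classical_set_scope.
Local Open Scope ring_scope.

Definition boundary (T : topologicalType) (S : set T) : set T :=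
  closure S `\` interior S.

Definition is_max (R : realType) (S : set R) (t : R) : Prop :=
  S t /\ ubound S t.

Definition is_min (R : realType) (S : set R) (t : R) : Prop :=
  S t /\ lbound S t.

Definition dotp (R : realType) (n : nat) (x y : 'rV[R]_n) : R :=
  (x *m y^T) 0 0.

(* The library norm `|x| on 'rV[R]_n is the sup norm. *)
Definition enorm (R : realType) (n : nat) (x : 'rV[R]_n) : R :=
  Num.sqrt (\sum_(i < n) x 0 i ^+ 2).

Definition quad_map (R : realType) (n : nat) (Q : 'I_n -> 'M[R]_n)
    (x : 'rV[R]_n) : 'rV[R]_n :=
  \row_(i < n) (x *m Q i *m x^T) 0 0.

Definition Fmap (R : realType) (n : nat) (Q : 'I_n -> 'M[R]_n) (L : 'M[R]_n)
    (x : 'rV[R]_n) : 'rV[R]_n :=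
  quad_map Q x + x *m L^T.

Definition polyhedron (R : realType) (m n : nat) (A : 'M[R]_(m, n))
    (b : 'rV[R]_m) : set 'rV[R]_n :=
  [set x | forall i, (x *m A^T) 0 i <= b 0 i].

Definition irredundant (R : realType) (m n : nat) (A : 'M[R]_(m, n))
    (b : 'rV[R]_m) : Prop :=
  forall i : 'I_m,
    [set x : 'rV[R]_n | forall j, j != i -> (x *m A^T) 0 j <= b 0 j]
      <> polyhedron A b.

Definition box (R : realType) (n : nat) (umin umax : 'rV[R]_n) :
    set 'rV[R]_n :=
  [set u | forall i, umin 0 i <= u 0 i /\ u 0 i <= umax 0 i].

Definition regular_value (R : realType) (n : nat)
    (f : 'rV[R]_n -> 'rV[R]_n) (D : set 'rV[R]_n) (y : 'rV[R]_n) : Prop :=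
  forall x, D x -> f x = y -> \det ('J f x) != 0.

(* Brouwer degree of a C^1 map f at y over a bounded open set D, for y outside
   f (boundary D): the signed number of preimages in D of any regular value y'
   with |y' - y| < dist (y, f (boundary D)).  Such y' exist by Sard's theorem
   and all give the same integer.  The distance is attained (D is bounded), so
   the strict bound is imposed pointwise; this also covers an empty boundary.
   Junk value 0 when y is in f (boundary D). *)
Definition brouwer_degree (R : realType) (n : nat)
    (f : 'rV[R]_n -> 'rV[R]_n) (D : set 'rV[R]_n) (y : 'rV[R]_n) : int :=
  xget 0 [set d : int | exists y' : 'rV[R]_n,
    [/\ forall x, boundary D x -> enorm (y' - y) < enorm (f x - y),
        regular_value f D y' &
        d = \sum_(x \in D `&` f @^-1` [set y']) sgz (\det ('J f x))]].

Definition robust_feasible (R : realType) (n : nat)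
    (F : 'rV[R]_n -> 'rV[R]_n) (Omega Omegau : set 'rV[R]_n) : Prop :=
  forall u, Omegau u -> exists2 x, interior Omega x & F x = u.

(* When the system is robust feasible and e <> 0, the admissible r form a
   half-line with a largest element, so the supremum is a maximum.  It is +oo
   when e = 0 and the system is robust feasible, and -oo when the system is not
   robust feasible. *)
Definition robustness_margin (R : realType) (n : nat)
    (F : 'rV[R]_n -> 'rV[R]_n) (Omega : set 'rV[R]_n)
    (ustar e : 'rV[R]_n) : \bar R :=
  ereal_sup [set r%:E | r in [set r : R |
    (forall i, 0 < e 0 i -> r <= e 0 i) /\
    robust_feasible F Omega (box (ustar - e) (ustar + e))]].

(* Main.v *)
Require Import Defs.
From mathcomp Require Import all_boot all_order all_algebra.
From mathcomp Require Import all_classical all_reals all_analysis.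
From mathcomp Require Import lra.

Import Order.TTheory GRing.Theory Num.Theory.
Import numFieldNormedType.Exports.

Local Open Scope classical_set_scope.
Local Open Scope ring_scope.

Set Implicit Arguments.
Unset Strict Implicit.

(** Let [K = F(Omega)].  A connected set that meets [K] and misses its
topological boundary lies inside [K], because its traces on the closure and on
the interior of [K] coincide and so form a clopen piece of it.  By assumption
the boundary of [K] is [F(boundary Omega)], and two kinds of segments miss it:

- Nonvanishing of the degree produces some [ustar + y'] in [K] with [y'] closer
  to the origin than any value of [F - ustar] on the boundary of [Omega].  The
  segment from [ustar + y'] to [ustar] stays within that distance of [ustar], so
  [ustar] is in [K] ([ustar_in_image]).
- Positivity of [z] says that no point of the box is a value of [F] on the
  boundary of [Omega] ([box_avoids_boundary_image]); the segments from [ustar]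
  to the other points of the box, which is convex, then keep the whole box
  inside [K].

A preimage in [Omega] of a point of the box cannot be a boundary point, hence it
is interior: this is robust feasibility, and with it [r] becomes one of the
numbers whose supremum is the margin. *)

(** The reason is that [C] meets [closure K] and [interior K] in the same set,
which is thus both relatively closed and relatively open in [C]. *)
Lemma connected_sub_of_avoids_boundary (T : topologicalType) (C K : set T) :
  connected C -> C `&` boundary K = set0 -> C `&` K !=set0 -> C `<=` K.
Proof.
move=> Cconn CbK [x [Cx Kx]].
have clint y : C y -> closure K y -> interior K y.
  move=> Cy clKy; apply: contrapT => nKy.
  by have : (C `&` boundary K) y by []; rewrite CbK.
suff <- : C `&` interior K = C by move=> y [_ /interior_subset].
apply: Cconn.
- by exists x; split=> //; apply: clint => //; exact: subset_closure.
- by exists (interior K) => //; exact: open_interior.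
- exists (closure K); first exact: closed_closure.
  apply/seteqP; split=> y [Cy Ky]; split=> //.
    by apply: subset_closure; exact: interior_subset.
  exact: clint.
Qed.

Lemma segment_stays_in (R : realType) (V : normedModType R) (K : set V)
    (a v : V) :
  (forall t : R, 0 <= t <= 1 -> ~ boundary K (a + t *: v)) ->
  K a -> K (a + v).
Proof.
move=> avoid Ka.
pose g (t : R) := a + t *: v.
have gcont : continuous g.
  by move=> t; apply: cvgD; [exact: cvg_cst | apply: cvgZr_tmp; exact: cvg_id].
have Cconn : connected (g @` [set` `[0, 1]]).
  apply: connected_continuous_connected; first exact: segment_connected.
  exact: continuous_subspaceT.
have CK : g @` [set` `[0, 1]] `<=` K.
  apply: connected_sub_of_avoids_boundary => //.
    rewrite -subset0 => _ [[t + <-]]; rewrite /= in_itv /=.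
    exact: avoid.
  exists a; split=> //; exists 0; last by rewrite /g scale0r addr0.
  by rewrite /= in_itv /= lexx ler01.
apply: CK; exists 1; last by rewrite /g scale1r.
by rewrite /= in_itv /= lexx ler01.
Qed.

(** Shrinking a convex set towards an interior point [x0] by the factor [1 - t]
carries a neighbourhood of [x0] to an open subset of [K] around the image of any
[x] in [K]; that image tends to [x] as [t] goes to [0]. *)
Lemma convex_sub_closure_interior (R : realType) (V : normedModType R)
    (K : set V) (x0 : V) :
  (forall x y (t : R), 0 <= t <= 1 -> K x -> K y -> K (x + t *: (y - x))) ->
  interior K x0 -> K `<=` closure (interior K).
Proof.
move=> convK Kx0 x Kx.
have shrink_int (t : R) : 0 < t <= 1 -> interior K (x + t *: (x0 - x)).
  move=> /andP[t0 t1].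
  pose h (q : V) := x + t^-1 *: (q - x).
  have hcont : continuous h.
    move=> q; apply: cvgD; first exact: cvg_cst.
    by apply: cvgZl_tmp; apply: cvgB; [exact: cvg_id | exact: cvg_cst].
  have hx0 : h (x + t *: (x0 - x)) = x0.
    by rewrite /h addrAC subrr add0r scalerA mulVf ?gt_eqF// scale1r subrKC.
  suff : nbhs (x + t *: (x0 - x)) K by [].
  have : nbhs (x + t *: (x0 - x)) (h @^-1` K) by apply: hcont; rewrite hx0.
  apply: filterS => q Khq; have := convK x (h q) t _ Kx Khq.
  rewrite (ltW t0) t1 => /(_ isT).
  by rewrite /h addrAC subrr add0r scalerA divff ?gt_eqF// scale1r subrKC.
have toward : x + t *: (x0 - x) @[t --> (0 : R)] --> x.
  rewrite -[X in _ --> X]addr0 -[X in _ --> _ + X](scale0r (x0 - x)).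
  by apply: cvgD; [exact: cvg_cst | apply: cvgZr_tmp; exact: cvg_id].
move=> B /toward /nbhs_ballP[d /= d0 dB].
have t_gt0 : 0 < Num.min 1 (d / 2) by rewrite lt_min ltr01 divr_gt0.
exists (x + Num.min 1 (d / 2) *: (x0 - x)); split.
  by apply: shrink_int; rewrite t_gt0 ge_min lexx.
apply: dB; rewrite /ball /= sub0r normrN gtr0_norm//.
by rewrite gt_min ltr_pdivrMr// ltr_pMr// ltr1n orbT.
Qed.

Lemma convex_boundary_sub_boundary_interior (R : realType)
    (V : normedModType R) (K : set V) (x0 : V) :
  (forall x y (t : R), 0 <= t <= 1 -> K x -> K y -> K (x + t *: (y - x))) ->
  interior K x0 -> boundary K `<=` boundary (interior K).
Proof.
move=> convK Kx0 x [clKx nKx]; split; last by move=> /interior_subset.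
rewrite (closure_id (closure (interior K))).1; last exact: closed_closure.
exact: closureS (convex_sub_closure_interior convK Kx0) _ clKx.
Qed.

Lemma polyhedron_convex (R : realType) (m n : nat) (A : 'M[R]_(m, n))
    (b : 'rV[R]_m) (x y : 'rV[R]_n) (t : R) :
  0 <= t <= 1 -> polyhedron A b x -> polyhedron A b y ->
  polyhedron A b (x + t *: (y - x)).
Proof.
move=> /andP[t0 t1] Ox Oy i; move: (Ox i) (Oy i).
rewrite mulmxDl -scalemxAl mulmxBl !mxE; nra.
Qed.

Lemma box_convex (R : realType) (n : nat) (umin umax x y : 'rV[R]_n) (t : R) :
  0 <= t <= 1 -> box umin umax x -> box umin umax y ->
  box umin umax (x + t *: (y - x)).
Proof.
move=> /andP[t0 t1] bx bY i; move: (bx i) (bY i).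
by rewrite !mxE => -[? ?] [? ?]; split; nra.
Qed.

Lemma enorm_shrink (R : realType) (n : nat) (t : R) (x : 'rV[R]_n) :
  0 <= t <= 1 -> enorm (t *: x) <= enorm x.
Proof.
move=> /andP[t0 t1]; apply: ler_wsqrtr; apply: ler_sum => i _.
by rewrite mxE exprMn ler_piMl ?sqr_ge0 // expr_le1.
Qed.

(** A nonzero signed count of the preimages of [y'] cannot be an empty sum. *)
Lemma brouwer_degree_neq0_near_value (R : realType) (n : nat)
    (f : 'rV[R]_n -> 'rV[R]_n) (D : set 'rV[R]_n) (y : 'rV[R]_n) :
  brouwer_degree f D y <> 0 ->
  exists2 y', forall x, boundary D x -> enorm (y' - y) < enorm (f x - y) &
    exists2 x, D x & f x = y'.
Proof.
rewrite /brouwer_degree; case: xgetP => // d _ [y' [near _ dE]] dN0.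
exists y' => //; apply: contrapT => noroot; apply: dN0.
rewrite dE (_ : D `&` _ = set0) ?fsbig_set0 // -subset0 => x [Dx fx].
by apply: noroot; exists x.
Qed.

(** The degree only sees [F] on the boundary of [interior Omega].  Convexity of
[Omega] makes this the whole boundary of [Omega], provided the interior is not
empty, and the root that the degree yields witnesses that. *)
Lemma ustar_in_image (R : realType) (n : nat) (F : 'rV[R]_n -> 'rV[R]_n)
    (Omega : set 'rV[R]_n) (ustar : 'rV[R]_n) :
  (forall x y (t : R),
    0 <= t <= 1 -> Omega x -> Omega y -> Omega (x + t *: (y - x))) ->
  brouwer_degree (fun x => F x - ustar) (interior Omega) 0 <> 0 ->
  boundary (F @` Omega) `<=` F @` boundary Omega ->
  (F @` Omega) ustar.
Proof.
move=> convO /brouwer_degree_neq0_near_value[y' near [x1 Ox1 Fx1]] bdF.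
rewrite -[X in (F @` Omega) X](subrK (F x1)) addrC.
apply: segment_stays_in; last by exists x1 => //; exact: interior_subset.
move=> t t01 /bdF[x bx Fx].
have := near x (convex_boundary_sub_boundary_interior convO Ox1 bx).
rewrite !subr0 Fx -opprB Fx1 scalerN.
have -> : F x1 - t *: y' - ustar = (1 - t) *: y'.
  by rewrite addrAC Fx1 scalerBl scale1r.
by rewrite ltNge enorm_shrink//; lra.
Qed.

(** If [F x = u], all the products [dotp lambda (F x - u)] vanish, so [0]
competes in the minimum that defines [z].  The attained value [z] provides the
unit vector needed for the maximum over the unit sphere to exist. *)
Lemma box_avoids_boundary_image (R : realType) (n : nat)
    (F : 'rV[R]_n -> 'rV[R]_n) (B U : set 'rV[R]_n) (z : R) :
  is_min
    [set t : R | exists x u, [/\ B x, U u &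
      is_max [set dotp lambda (F x - u)
             | lambda in [set lambda : 'rV[R]_n | enorm lambda = 1]] t]] z ->
  0 < z -> forall x, B x -> ~ U (F x).
Proof.
move=> [[x1 [u1 [_ _ [[lam lam1 _] _]]]] zmin] z0 x Bx Ux.
have dot0 (l : 'rV[R]_n) : dotp l (F x - F x) = 0.
  by rewrite subrr /dotp trmx0 mulmx0 mxE.
suff /zmin : [set t : R | exists x u, [/\ B x, U u &
    is_max [set dotp lambda (F x - u)
           | lambda in [set lambda : 'rV[R]_n | enorm lambda = 1]] t]] 0.
  by rewrite leNgt z0.
exists x, (F x); split=> //; split; first by exists lam.
by move=> _ [l _ <-]; rewrite dot0.
Qed.

Unset Implicit Arguments.

Theorem theorem4p1 (R : realType) (m n : nat)
    (Q : 'I_n -> 'M[R]_n) (L : 'M[R]_n) (A : 'M[R]_(m, n)) (b : 'rV[R]_m)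
    (ustar e : 'rV[R]_n) :
  let Omega := polyhedron A b in
  let Omegau := box (ustar - e) (ustar + e) in
  let F := Fmap Q L in
  forall (e_ge0 : forall i, 0 <= e 0 i)
    (Ab_irredundant : irredundant A b)
    (Omega_bounded : bounded_set Omega)
    (degree_defined : forall x, boundary Omega x -> F x <> ustar)
    (degree_neq0 :
      brouwer_degree (fun x => F x - ustar) (interior Omega) 0 <> 0)
    (boundary_image : boundary (F @` Omega) = F @` boundary Omega)
    (z : R)
    (z_def : is_min
      [set t : R | exists x u, [/\ boundary Omega x, Omegau u &
        is_max [set dotp lambda (F x - u)
               | lambda in [set lambda : 'rV[R]_n | enorm lambda = 1]] t]] z)
    (r : R) (r_gt0 : 0 < r)
    (r_le : forall i, 0 < e 0 i -> r <= e 0 i)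
    (z_gt0 : 0 < z),
  robust_feasible F Omega Omegau /\
  (r%:E <= robustness_margin F Omega ustar e)%E.
Proof.
move=> Omega Omegau F e_ge0 _ _ _ deg_neq0 bdF z z_def r r_gt0 r_le z_gt0.
have avoid := box_avoids_boundary_image z_def z_gt0.
have box_ustar : Omegau ustar.
  by move=> i; rewrite !mxE; have := e_ge0 i; split; lra.
have Kustar : (F @` Omega) ustar.
  apply: ustar_in_image => //; last by rewrite bdF.
  exact: polyhedron_convex.
have robust : robust_feasible F Omega Omegau.
  move=> u box_u.
  have [x Ox Fx] : (F @` Omega) u.
    rewrite -[X in (F @` Omega) X](subrKC ustar u).
    apply: segment_stays_in => // t t01; rewrite bdF => -[x bx Fx].
    by apply: (avoid x bx); rewrite Fx; exact: box_convex.
  exists x => //; apply: contrapT => nOx.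
  apply: (avoid x); last by rewrite Fx.
  by split=> //; exact: subset_closure.
by split=> //; apply: ereal_sup_ubound; exists r.
Qed.
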